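(* The cut rule is admissible in $\mathsf{G3DM}$: for all DM-structures $\Sigma,\Theta$ and terms $\varphi,\psi$, if $\mathsf{G3DM}\vdash\Sigma\Rightarrow\varphi$ and $\mathsf{G3DM}\vdash\varphi,\Theta\Rightarrow\psi$, then $\mathsf{G3DM}\vdash\Sigma,\Theta\Rightarrow\psi$.
   Context: Let $\Xi=\{p_n\mid n\in\omega\}$ be a denumerable set of propositional variables. Terms are generated by $\varphi::=p\mid\bot\mid{\sim}\varphi\mid(\varphi\wedge\varphi)\mid(\varphi\vee\varphi)$ with $p\in\Xi$. A DM-structure is a finite multiset of terms; the comma denotes multiset union. A DM-sequent is $\Sigma\Rightarrow\varphi$ with $\Sigma$ a DM-structure and $\varphi$ a term. The calculus $\mathsf{G3DM}$ (with $p\in\Xi$, all Greek lowercase letters arbitrary terms, $\Sigma$ an arbitrary DM-structure) has axioms: $p,\Sigma\Rightarrow p$; ${\sim}p,\Sigma\Rightarrow{\sim}p$; $\bot,\Sigma\Rightarrow\varphi$; $\Sigma\Rightarrow{\sim}\bot$. Rules: from $\varphi,\psi,\Sigma\Rightarrow\chi$ infer $\varphi\wedge\psi,\Sigma\Rightarrow\chi$; from $\Sigma\Rightarrow\varphi$ and $\Sigma\Rightarrow\psi$ infer $\Sigma\Rightarrow\varphi\wedge\psi$; from $\varphi,\Sigma\Rightarrow\chi$ and $\psi,\Sigma\Rightarrow\chi$ infer $\varphi\vee\psi,\Sigma\Rightarrow\chi$; from $\Sigma\Rightarrow\varphi_i$ ($i=1$ or $2$) infer $\Sigma\Rightarrow\varphi_1\vee\varphi_2$;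 from ${\sim}\varphi,\Sigma\Rightarrow\chi$ and ${\sim}\psi,\Sigma\Rightarrow\chi$ infer ${\sim}(\varphi\wedge\psi),\Sigma\Rightarrow\chi$; from $\Sigma\Rightarrow{\sim}\varphi_i$ ($i=1$ or $2$) infer $\Sigma\Rightarrow{\sim}(\varphi_1\wedge\varphi_2)$; from ${\sim}\varphi,{\sim}\psi,\Sigma\Rightarrow\chi$ infer ${\sim}(\varphi\vee\psi),\Sigma\Rightarrow\chi$; from $\Sigma\Rightarrow{\sim}\varphi$ and $\Sigma\Rightarrow{\sim}\psi$ infer $\Sigma\Rightarrow{\sim}(\varphi\vee\psi)$; from $\varphi,\Sigma\Rightarrow\chi$ infer ${\sim}{\sim}\varphi,\Sigma\Rightarrow\chi$; from $\Sigma\Rightarrow\varphi$ infer $\Sigma\Rightarrow{\sim}{\sim}\varphi$. $\mathsf{G3DM}\vdash\Sigma\Rightarrow\varphi$ means that $\Sigma\Rightarrow\varphi$ has a derivation from these axioms by these rules. *)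

(* Defs.v *)
From HB Require Import structures.
From mathcomp Require Import all_boot finmap multiset.

Set Implicit Arguments.
Unset Strict Implicit.
Unset Printing Implicit Defensive.

Local Open Scope mset_scope.

(* [Var n] is the propositional variable p_n. *)
Inductive term : Type :=
  | Var of nat
  | Bot
  | Neg of term
  | And of term & term
  | Or of term & term.

(* {mset term} needs a choiceType, obtained by encoding terms as trees. *)
Fixpoint term_encode (a : term) : GenTree.tree nat :=
  match a with
  | Var n => GenTree.Leaf n
  | Bot => GenTree.Node 0 [::]
  | Neg a => GenTree.Node 1 [:: term_encode a]
  | And a b => GenTree.Node 2 [:: term_encode a; term_encode b]
  | Or a b => GenTree.Node 3 [:: term_encode a; term_encode b]
  end.

Fixpoint term_decode (t : GenTree.tree nat) : option term :=
  match t with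
  | GenTree.Leaf n => Some (Var n)
  | GenTree.Node 0 [::] => Some Bot
  | GenTree.Node 1 [:: t] => omap Neg (term_decode t)
  | GenTree.Node 2 [:: t; u] =>
      if (term_decode t, term_decode u) is (Some a, Some b)
      then Some (And a b) else None
  | GenTree.Node 3 [:: t; u] =>
      if (term_decode t, term_decode u) is (Some a, Some b)
      then Some (Or a b) else None
  | _ => None
  end.

Lemma term_encodeK : pcancel term_encode term_decode.
Proof. by elim=> //= [a ->|a -> b ->|a -> b ->]. Qed.

HB.instance Definition _ := Countable.copy term (pcan_type term_encodeK).

Notation DMstructure := {mset term}.

Declare Scope dm_scope.
Delimit Scope dm_scope with dm.
Bind Scope dm_scope with term.

Notation "⊥" := Bot : dm_scope.
Notation "∼ a" := (Neg a) (at level 35, right associativity) : dm_scope.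
Notation "a ∧ b" := (And a b) (at level 80, right associativity) : dm_scope.
Notation "a ∨ b" := (Or a b) (at level 85, right associativity) : dm_scope.

(* In a structure, "a +` S" is the multiset S with one more occurrence of a. *)
Inductive G3DM : DMstructure -> term -> Prop :=
  | AxVar n S : G3DM (Var n +` S) (Var n)
  | AxNegVar n S : G3DM ((∼ Var n)%dm +` S) (∼ Var n)
  | AxBotL S a : G3DM (⊥%dm +` S) a
  | AxNegBotR S : G3DM S (∼ ⊥)
  | AndL a b S c : G3DM (a +` (b +` S)) c -> G3DM ((a ∧ b)%dm +` S) c
  | AndR a b S : G3DM S a -> G3DM S b -> G3DM S (a ∧ b)
  | OrL a b S c :
      G3DM (a +` S) c -> G3DM (b +` S) c -> G3DM ((a ∨ b)%dm +` S) c
  | OrR1 a b S : G3DM S a -> G3DM S (a ∨ b)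
  | OrR2 a b S : G3DM S b -> G3DM S (a ∨ b)
  | NegAndL a b S c :
      G3DM ((∼ a)%dm +` S) c -> G3DM ((∼ b)%dm +` S) c ->
      G3DM ((∼ (a ∧ b))%dm +` S) c
  | NegAndR1 a b S : G3DM S (∼ a) -> G3DM S (∼ (a ∧ b))
  | NegAndR2 a b S : G3DM S (∼ b) -> G3DM S (∼ (a ∧ b))
  | NegOrL a b S c :
      G3DM ((∼ a)%dm +` ((∼ b)%dm +` S)) c -> G3DM ((∼ (a ∨ b))%dm +` S) c
  | NegOrR a b S : G3DM S (∼ a) -> G3DM S (∼ b) -> G3DM S (∼ (a ∨ b))
  | NegNegL a S c : G3DM (a +` S) c -> G3DM ((∼ ∼ a)%dm +` S) c
  | NegNegR a S : G3DM S a -> G3DM S (∼ ∼ a).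

(* Main.v *)
Require Import Defs.
From mathcomp Require Import all_boot finmap multiset.
From mathcomp Require Import zify.

Set Implicit Arguments.
Unset Strict Implicit.
Unset Printing Implicit Defensive.

Local Open Scope mset_scope.

(** Cut is obtained semantically: [G3DM] is sound and complete for
    first-degree entailment over four-valued valuations, and entailment is
    transitive.

    A four-valued valuation is given by two independent Boolean values for each
    variable, one for [p] and one for [∼ p]; it extends to every term and its
    negation by the De Morgan clauses. Soundness ([G3DM_sound]) is a direct
    induction on derivations.

    Completeness ([G3DM_complete]) rests on two facts. Every left rule is
    semantically invertible and makes the antecedent smaller, so a valid sequent
    can be reduced, bottom-up, to valid sequents whose antecedents contain only
    literals [p], [∼ p] and [∼ ⊥] (or to instances of the axiom for [⊥]). Such
    an antecedent has a canonical valuation, making true exactly the signed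
    variables that occur in it; whatever is true there is derivable from axioms
    by right rules alone ([canonical_derivable]). This valuation exists for every
    set of literals because [p] and [∼ p] may be both true or both false, and it
    splits disjunctions: a true one has a true disjunct, as the right rules for
    [∨] demand. *)

(** * Four-valued semantics *)

(** [v true n] and [v false n] are the truth values of [p_n] and of [∼ p_n];
    [holds v true a] is the truth of [a], and [holds v false a] that of [∼ a]. *)
Fixpoint holds (v : bool -> nat -> bool) (s : bool) (a : term) : bool :=
  match a with
  | Var n => v s n
  | Bot => ~~ s
  | Neg a => holds v (~~ s) a
  | And a b => if s then holds v s a && holds v s b
               else holds v s a || holds v s b
  | Or a b => if s then holds v s a || holds v s b
              else holds v s a && holds v s b
  end.

Definition models v (S : DMstructure) := forall a, a \in S -> holds v true a.

Definition entails S c := forall v, models v S -> holds v true c.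

Lemma modelsD v S T : models v (S `+` T) <-> models v S /\ models v T.
Proof.
split=> [vST|[vS vT] a]; last by rewrite in_msetD => /orP[/vS|/vT].
by split=> a aST; apply: vST; rewrite in_msetD aST ?orbT.
Qed.

Lemma models1D v a S : models v (a +` S) <-> holds v true a /\ models v S.
Proof.
rewrite modelsD; split=> -[va vS]; split=> //; first by apply: va; rewrite in_mset1.
by move=> b; rewrite in_mset1 => /eqP->.
Qed.

Lemma G3DM_sound S c : G3DM S c -> entails S c.
Proof.
move=> der v; elim: der => {S c} /=.
- by move=> n S /models1D[].
- by move=> n S /models1D[].
- by move=> S a /models1D[].
- by [].
- by move=> a b S c _ IH /models1D[/andP[va vb] vS]; apply: IH; rewrite !models1D.
- by move=> a b S _ IHa _ IHb vS; rewrite IHa ?IHb.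
- by move=> a b S c _ IHa _ IHb /models1D[/orP[va|vb] vS];
    [apply: IHa|apply: IHb]; rewrite models1D.
- by move=> a b S _ IH vS; rewrite IH.
- by move=> a b S _ IH vS; rewrite IH ?orbT.
- by move=> a b S c _ IHa _ IHb /models1D[/orP[va|vb] vS];
    [apply: IHa|apply: IHb]; rewrite models1D.
- by move=> a b S _ IH vS; rewrite IH.
- by move=> a b S _ IH vS; rewrite IH ?orbT.
- by move=> a b S c _ IH /models1D[/andP[va vb] vS]; apply: IH; rewrite !models1D.
- by move=> a b S _ IHa _ IHb vS; rewrite IHa ?IHb.
- by move=> a S c _ IH /models1D[va vS]; apply: IH; rewrite models1D.
- by move=> a S _ IH vS; apply: IH.
Qed.

(** * Completeness *)

Definition signed (s : bool) (a : term) : term := if s then a else Neg a.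

Definition canonical (S : DMstructure) (s : bool) (n : nat) : bool :=
  signed s (Var n) \in S.

(** The axioms cover the variables, and each clause of [holds] is a right rule
    read from its premises to its conclusion. The sign has to be general because
    the right rules for [∼] recurse on negated subterms. *)
Lemma canonical_derivable S s c : holds (canonical S) s c -> G3DM S (signed s c).
Proof.
elim: c s => [n||a IH|a IHa b IHb|a IHa b IHb] [] //=.
- by move=> /msetB1K <-; apply: AxVar.
- by move=> /msetB1K <-; apply: AxNegVar.
- by move=> _; apply: AxNegBotR.
- by move=> /IH.
- by move=> /IH; apply: NegNegR.
- by move=> /andP[/IHa Ha /IHb Hb]; apply: AndR.
- by move=> /orP[/IHa|/IHb]; [apply: NegAndR1|apply: NegAndR2].
- by move=> /orP[/IHa|/IHb]; [apply: OrR1|apply: OrR2].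
- by move=> /andP[/IHa Ha /IHb Hb]; apply: NegOrR.
Qed.

Definition literal (a : term) : bool :=
  match a with
  | Var _ | Neg (Var _) | Neg Bot => true
  | _ => false
  end.

Lemma models_canonical L :
  (forall a, a \in L -> literal a) -> models (canonical L) L.
Proof. by move=> litL a aL; case: a aL (litL a aL) => //= -[]. Qed.

(** Connectives weigh 2, so that replacing [∼ (a ∨ b)] by the two terms [∼ a]
    and [∼ b], which has one negation more, still decreases the total. *)
Fixpoint weight (a : term) : nat :=
  match a with
  | Var _ | Bot => 1
  | Neg a => (weight a).+1
  | And a b | Or a b => (weight a + weight b).+2
  end.

(** The terms of [l] are still to be decomposed, those of [L] are the literals
    met so far. A literal at the head of [l] is moved to [L]; any other term is
    the principal formula of a left rule or of the axiom for [⊥]. *)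
Lemma entails_derivable l L c :
  (forall a, a \in L -> literal a) ->
  entails (seq_mset l `+` L) c -> G3DM (seq_mset l `+` L) c.
Proof.
have [n] := ubnP (sumn (map weight l)); elim: n l L => // n IHn [|a l] L /=.
  move=> _ litL; have -> : seq_mset [::] `+` L = L.
    by apply/msetP => a; rewrite msetE2 mset_seqE.
  move=> valid; apply: (@canonical_derivable L true c).
  exact/valid/models_canonical.
move=> le_n litL.
have consE b k : seq_mset (b :: k) `+` L = b +` (seq_mset k `+` L).
  by rewrite mset_cons msetDA.
rewrite consE => valid.
(* A premise with principal part [k] follows by induction as soon as the truth
   of [k] implies that of the principal formula. *)
have premise k : sumn (map weight (k ++ l)) < n ->
    (forall v, models v (seq_mset (k ++ l) `+` L) ->
       holds v true a /\ models v (seq_mset l `+` L)) ->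
    G3DM (seq_mset (k ++ l) `+` L) c.
  move=> lt_n imp; apply: IHn => // v vkl.
  by apply: valid; rewrite models1D; apply: imp.
have shift : literal a -> G3DM (a +` (seq_mset l `+` L)) c.
  move=> lit_a; rewrite msetDCA; apply: IHn; last by rewrite msetDCA.
    by case: (a) lit_a le_n => //= *; lia.
  by move=> b; rewrite in_mset1D => /orP[/eqP->|/litL].
case: a valid le_n premise shift => [p||a|a b|a b] valid /= le_n premise shift.
- exact: shift.
- exact: AxBotL.
- case: a valid le_n premise shift => [p||a|a b|a b] valid /= le_n premise shift.
  + exact: shift.
  + exact: shift.
  + apply: NegNegL; have := premise [:: a]; rewrite /= consE; apply; first by lia.
    by move=> v; rewrite models1D.
  + apply: NegAndL.
      have := premise [:: Neg a]; rewrite /= consE; apply; first by lia.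
      by move=> v; rewrite models1D => -[/= ->].
    have := premise [:: Neg b]; rewrite /= consE; apply; first by lia.
    by move=> v; rewrite models1D => -[/= ->]; rewrite orbT.
  + apply: NegOrL; have := premise [:: Neg a; Neg b].
    rewrite /= !consE; apply; first by lia.
    by move=> v; rewrite !models1D => -[/= -> [->]].
- apply: AndL; have := premise [:: a; b]; rewrite /= !consE; apply; first by lia.
  by move=> v; rewrite !models1D => -[/= -> [->]].
- apply: OrL.
    have := premise [:: a]; rewrite /= consE; apply; first by lia.
    by move=> v; rewrite models1D => -[/= ->].
  have := premise [:: b]; rewrite /= consE; apply; first by lia.
  by move=> v; rewrite models1D => -[/= ->]; rewrite orbT.
Qed.

Lemma G3DM_complete S c : entails S c -> G3DM S c.
Proof.
have := @entails_derivable S mset0 c; rewrite msetD0 seq_mset_id; apply.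
by move=> a; rewrite in_mset0.
Qed.

(** * Cut *)

Theorem theorem4p6 (Sigma Theta : {mset term}%mset) (phi psi : term) :
  G3DM Sigma phi -> G3DM (phi +` Theta)%mset psi -> G3DM (Sigma `+` Theta)%mset psi.
Proof.
move=> /G3DM_sound Sphi /G3DM_sound phiTpsi; apply: G3DM_complete => v.
by rewrite modelsD => -[/Sphi vphi vT]; apply: phiTpsi; rewrite models1D.
Qed.
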